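(* Let $r, s \ge 1$ be integers. Let $G$ be a graph, and let $V_1,\dots,V_t$ be a partition of $V(G)$ such that the quotient graph $G/(V_1,\dots,V_t)$ is a tree. Suppose that for each pair $V_i, V_j$ it holds that $|N(V_i) \cap V_j| \le r$. If $\mathrm{HG}_s(G[V_i]) < \ell$ for all $1 \le i \le t$, then $\mathrm{HG}_s(G) \le (3\ell)^{r \ell^{r-1}}$ when $r \ge 2$, and $\mathrm{HG}_s(G) \le \ell(\ell-1)$ when $r = 1$.
   Context: All graphs are finite and simple; $G[U]$ is the induced subgraph on $U$. For $U\subseteq V(G)$, $N(U)$ denotes the set of vertices with at least one neighbor in $U$. The quotient graph $G/(V_1,\dots,V_t)$ has vertices $V_1,\dots,V_t$, with $V_i$ adjacent to $V_j$ ($i\ne j$) iff some edge of $G$ joins $V_i$ and $V_j$. For an integer $s\ge1$, $\mathrm{HG}_s(G)$ is the maximum $k$ such that, with color set $\{1,\dots,k\}$, there is a strategy (each vertex $v$ has a function mapping each coloring of its neighborhood $N(v)$ to a set of at most $s$ colors) such that for every coloring $\phi:V(G)\to\{1,\dots,k\}$ some vertex $v$ has $\phi(v)$ in the set its function assigns to $\phi|_{N(v)}$. *)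

(* Defs.v *)
From mathcomp Require Import all_boot all_algebra.

Set Implicit Arguments.
Unset Strict Implicit.
Unset Printing Implicit Defensive.

Lemma sum_constT (T : finType) n : \sum_(x : T) n = #|T| * n.
Proof. exact: (sum_nat_const T n). Qed.

Record sgraph := SGraph {
  svertex :> finType;
  adj : rel svertex;
  adj_sym : symmetric adj;
  adj_irr : irreflexive adj }.

Definition nbrs (G : sgraph) (U : {set G}) : {set G} :=
  [set y | [exists x in U, adj y x]].

Section Induced.
Variables (G : sgraph) (U : {set G}).

Definition induced_adj : rel {x : G | x \in U} := fun x y => adj (val x) (val y).

Lemma induced_sym : symmetric induced_adj.
Proof. by move=> x y; apply: adj_sym. Qed.

Lemma induced_irr : irreflexive induced_adj.
Proof. by move=> x; apply: adj_irr. Qed.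

Definition induced : sgraph := SGraph induced_sym induced_irr.
End Induced.

Section Quotient.
Variables (G : sgraph) (P : {set {set G}}).

Definition quotient_adj : rel {A : {set G} | A \in P} := fun A B =>
  (A != B) && [exists x in val A, exists y in val B, adj x y].

Lemma quotient_sym : symmetric quotient_adj.
Proof.
move=> A B; rewrite /quotient_adj eq_sym; congr (_ && _).
by apply/exists_inP/exists_inP => -[x xA /exists_inP[y yB xy]];
  exists y => //; apply/exists_inP; exists x; rewrite // adj_sym.
Qed.

Lemma quotient_irr : irreflexive quotient_adj.
Proof. by move=> A; rewrite /quotient_adj eqxx. Qed.

Definition quotient_graph : sgraph := SGraph quotient_sym quotient_irr.
End Quotient.

Definition connected_graph (G : sgraph) : Prop :=
  0 < #|G| /\ forall x y : G, connect (@adj G) x y.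

(* The bound on the size excludes the degenerate closed walks [:: x; y]
   running back and forth along an edge, which ucycle accepts. *)
Definition acyclic_graph (G : sgraph) : Prop :=
  forall c : seq G, 2 < size c -> ~ ucycle (@adj G) c.

Definition is_tree (G : sgraph) : Prop :=
  connected_graph G /\ acyclic_graph G.

Section HatGuessing.
Variables (s : nat) (G : sgraph).

Definition coloring (k : nat) := {ffun G -> 'I_k}.

Definition nbr_coloring (k : nat) (v : G) := {ffun {w : G | adj v w} -> 'I_k}.

Definition restrict k (phi : coloring k) (v : G) : nbr_coloring k v :=
  [ffun w => phi (val w)].

Definition strategy (k : nat) :=
  {dffun forall v : G, {ffun nbr_coloring k v -> {set 'I_k}}}.

Definition winning k (F : strategy k) : bool :=
  [forall v : G, forall c : nbr_coloring k v, #|F v c| <= s] &&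
  [forall phi : coloring k, exists v : G, phi v \in F v (restrict phi v)].

Definition has_winning (k : nat) : bool := [exists F : strategy k, winning F].

(* The range of k is no restriction, by has_winning_bound below. The graph
   with no vertex has no winning strategy for any k, and HG is then 0. *)
Definition HG : nat := \max_(k < (s * #|G|).+1 | has_winning k) k.

Lemma has_winning_bound k : has_winning k -> k <= s * #|G|.
Proof.
case: k => // k /existsP[F /andP[/forallP sF /forallP winF]].
pose good v (phi : coloring k.+1) := phi v \in F v (restrict phi v).
pose shift v (c : 'I_k.+1) (phi : coloring k.+1) : coloring k.+1 :=
  [ffun w => if w == v then (phi w + c)%R else phi w].
have shift_inj v c : injective (shift v c).
  move=> f g /ffunP fg; apply/ffunP => w; move/(_ w): fg; rewrite !ffunE.
  by case: eqP => // _ /GRing.addIr.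
have restr v c phi : restrict (shift v c phi) v = restrict phi v.
  apply/ffunP => -[w vw]; rewrite !ffunE /=; case: eqP => // wv.
  by move: vw; rewrite wv adj_irr.
have le_good v : k.+1 * (\sum_phi good v phi) <= s * #|{: coloring k.+1}|.
  have -> : k.+1 * (\sum_phi good v phi) =
      \sum_(c : 'I_k.+1) \sum_phi good v (shift v c phi).
    transitivity (\sum_(c : 'I_k.+1) \sum_phi good v phi).
      by rewrite sum_constT card_ord.
    by apply: eq_bigr => c _; rewrite [LHS](reindex_inj (@shift_inj v c)).
  rewrite exchange_big mulnC -sum_constT; apply: leq_sum => phi _.
  apply: leq_trans (forallP (sF v) (restrict phi v)).
  rewrite -big_mkcond sum1_card.
  rewrite -(card_imset _ (@GRing.addrI _ (phi v))); apply: subset_leq_card.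
  apply/subsetP => _ /imsetP[c gc ->]; move: (gc : good v (shift v c phi)).
  by rewrite /good restr ffunE eqxx.
have colN0 : 0 < #|{: coloring k.+1}|.
  by apply/card_gt0P; exists [ffun=> ord0].
rewrite -(leq_pmul2r colN0).
have le1 : #|{: coloring k.+1}| <= \sum_phi \sum_v good v phi.
  rewrite -sum1_card; apply: leq_sum => phi _.
  by have /existsP[v gv] := winF phi; rewrite (bigD1 v) //= /good gv.
apply: (leq_trans (leq_mul (leqnn k.+1) le1)).
rewrite exchange_big big_distrr /= -mulnA mulnCA -sum_constT.
exact: leq_sum.
Qed.

Lemma has_winning_leq k : has_winning k -> k <= HG.
Proof.
move=> wk; have lek : k < (s * #|G|).+1 by rewrite ltnS has_winning_bound.
exact: (@leq_bigmax_cond _ _ (fun i : 'I__ => val i) (Ordinal lek)).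
Qed.

Lemma has_winning_HG : 0 < #|G| -> has_winning HG.
Proof.
move=> /card_gt0P[v0 _]; have w0 : has_winning 0.
  apply/existsP; exists [ffun v => [ffun=> set0]]; apply/andP; split.
    by apply/forallP => v; apply/forallP => c; rewrite !ffunE cards0.
  by apply/forallP => phi; case: (phi v0).
by rewrite /HG; apply: (big_ind has_winning) => // m n wm wn; rewrite /maxn; case: ifP.
Qed.
End HatGuessing.

(* Main.v *)
(** Root the tree of parts at U.  By induction, for every coloring outside a
subtree and every choice of lists of l colors on its root part, the subtree has
a coloring from these lists in which every vertex of the subtree guesses wrong.
To add a child W with its subtree Y, fix first the colors of the at most r
vertices of W that U sees: given a coloring of the at most r vertices of U that
W sees, the colorings of these vertices of W that do not extend to a losing
coloring of Y contain no l x ... x l box, by the induction hypothesis for W.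
By the Kovari-Sos-Turan-Erdos argument such a set has density less than l^(-r),
hence some coloring is bad for none of the at most l^r colorings that U may
choose from its lists.  The induction starts from single parts, where lists
of l > HG_s(G[U]) colors do not suffice to win. *)

Require Import Defs.
From mathcomp Require Import all_boot zify.

Set Implicit Arguments.
Unset Strict Implicit.
Unset Printing Implicit Defensive.

(* The convex sequence d |-> 'C(d, l.+1) lies above its tangent at m. *)
Lemma bin_tangent l m d :
  'C(m, l.+1) + d * 'C(m, l) <= 'C(d, l.+1) + m * 'C(m, l).
Proof.
case: (leqP m d) => [|/ltnW] /subnKC <-.
- elim: (d - m) => [|j IHj]; first by rewrite addn0.
  by have := leq_bin2l l (leq_addr j m); rewrite addnS binS; lia.
- elim: (m - d) => [|j IHj]; first by rewrite addn0.
  by have := leq_bin2l l (leqnSn (d + j)); rewrite addnS binS; nia.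
Qed.

Lemma pigeonhole_sum (I : finType) (P : pred I) (F : I -> nat) n :
  0 < n -> n <= \sum_(i | P i) F i -> exists2 i, P i & n <= F i * #|P|.
Proof.
move=> n0 len; have [i0 Pi0] : exists i, P i.
  apply/existsP; apply: contraTT len; rewrite negb_exists -ltnNge => /forallP nP.
  by rewrite big1 // => i Pi; rewrite (negbTE (nP i)) in Pi.
case: (arg_maxnP F Pi0) => i Pi maxi; exists i => //; apply: leq_trans len _.
by rewrite mulnC -sum_nat_const; apply: leq_sum.
Qed.

Lemma ex_subset_card (T : finType) (A : {set T}) n :
  n <= #|A| -> exists2 C : {set T}, C \subset A & #|C| = n.
Proof.
rewrite -bin_gt0 -cards_draws => /card_gt0P[C].
by rewrite inE => /andP[CA /eqP]; exists C.
Qed.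

(** * Dense sets of colorings contain boxes *)

Section Boxes.
Variables T K : finType.
Implicit Types (f g : {ffun T -> K}) (S : {set {ffun T -> K}}) (B : {set T}).

Definition update f b c : {ffun T -> K} := [ffun v => if v == b then c else f v].

(** A set of colorings of [B] is encoded as a cylinder among all colorings, so densities keep the
    denominator [#|K| ^ #|T|] while [B] shrinks. *)
Definition depends_on S B :=
  forall f g, {in B, f =1 g} -> (f \in S) = (g \in S).

Definition contains_box S B l :=
  exists2 L : T -> {set K}, forall v, #|L v| = l &
    forall f, {in B, forall v, f v \in L v} -> f \in S.

(** Exchanging [f b] with the extra color [c] is an involution on pairs; it carries the left-hand
    count to the pairs with [f \in S]. *)
Lemma sum_card_fibers S b :
  \sum_f #|[set c | update f b c \in S]| = #|K| * #|S|.
Proof.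
pose swap (p : {ffun T -> K} * K) := (update p.1 b p.2, p.1 b).
have swapK : involutive swap.
  move=> [f c]; rewrite /swap /= ffunE eqxx; congr (_, _).
  by apply/ffunP => v; rewrite !ffunE /= ; case: eqP => [->|].
transitivity (\sum_(p : {ffun T -> K} * K) (update p.1 b p.2 \in S : nat)).
  rewrite -(pair_bigA _ (fun f c => (update f b c \in S : nat))) /=.
  by apply: eq_bigr => f _; rewrite -sum1dep_card big_mkcond.
rewrite (reindex_inj (inv_inj swapK)) /=.
rewrite (eq_bigr (fun p => (p.1 \in S) : nat)) => [|p _]; last first.
  by have /(congr1 fst)/= -> := swapK p.
rewrite -(pair_bigA _ (fun f (c : K) => (f \in S : nat))) /= exchange_big /=.
by rewrite sum_nat_const -[#|S|]sum1_card [in RHS]big_mkcond.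
Qed.

(** At most one color decides membership in [S], and density [1 / D] leaves at least
    [#|K| / D > l.-1] choices for it. With [D = l] this gives the bound [l * (l - 1)] for
    [r = 1]. *)
Lemma box_subset1 S B l D :
  #|B| <= 1 -> depends_on S B -> #|K| ^ #|T| <= #|S| * D ->
  l.-1 * D < #|K| -> contains_box S B l.
Proof.
move=> B1 depS leS ltK.
have K0 : 0 < #|K| by apply: leq_trans ltK.
have KT0 : 0 < #|K| ^ #|T| by rewrite expn_gt0 K0.
have D0 : 0 < D by case: D {ltK} leS => //; rewrite muln0; lia.
have [f0 f0S] : exists f, f \in S.
  by apply/card_gt0P; case: #|S| leS => //; rewrite mul0n; lia.
have lK : l <= #|K| by case: l ltK => // l; nia.
have [C _ cC] : exists2 C : {set K}, C \subset setT & #|C| = l.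
  by apply: ex_subset_card; rewrite cardsT.
have [B0|[b Bb]] : B = set0 \/ exists b, B = [set b].
  by move: B1; rewrite leq_eqVlt ltnS leqn0 cards_eq0 => /orP[/cards1P|/eqP]; auto.
  exists (fun=> C) => // f _; rewrite (depS f f0) // => v.
  by rewrite B0 inE.
pose C0 := [set c | update f0 b c \in S].
have eC0 f : [set c | update f b c \in S] = C0.
  apply/setP => c; rewrite !inE; apply: depS => v.
  by rewrite Bb inE => /eqP ->; rewrite !ffunE eqxx.
have eqC0 := sum_card_fibers S b.
rewrite (eq_bigr (fun=> #|C0|)) in eqC0; last by move=> f _; rewrite eC0.
rewrite sum_nat_const card_ffun in eqC0.
have : #|K| <= #|C0| * D.
  rewrite -(leq_pmul2l KT0) mulnA eqC0 mulnC -mulnA leq_mul2l leS.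
  by rewrite orbT.
move=> leC0; have {}leC0 : l <= #|C0|.
  by case: l ltK {lK cC} => // l ltK; rewrite -(ltn_pmul2r D0); lia.
have [C' /subsetP sC' cC'] := ex_subset_card leC0.
exists (fun=> C') => // f fC'.
have /sC' : f b \in C' by apply: fC'; rewrite Bb inE.
rewrite -(eC0 f) inE; congr (_ \in S); apply/ffunP => v.
by rewrite ffunE; case: eqP => // ->.
Qed.

(** Falling factorials are compared factor by factor; the 2 absorbs the rounding in [k %/ D] and the
    shifts [i < l]. *)
Lemma bin_ratio l k D : 0 < D -> 2 * D * l <= k ->
  'C(k, l) <= (2 * D) ^ l * 'C(k %/ D, l).
Proof.
move=> D0 lek.
have fact_gt := fact_gt0 l.
rewrite -(leq_pmul2r fact_gt) -mulnA !bin_ffact.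
have ediv := divn_eq k D; have modlt := ltn_pmod k D0.
set m := k %/ D in ediv *.
have hm i : i < l -> k - i <= 2 * D * (m - i).
  move=> il; have : D * i.+1 <= D * l by rewrite leq_pmul2l.
  clear fact_gt; rewrite mulnS mulnBr -!mulnA; nia.
have -> : (2 * D) ^ l = \prod_(i < l) (2 * D).
  by rewrite prod_nat_const card_ord.
by rewrite !ffact_prod -big_split /=; apply: leq_prod => i _; apply: hm.
Qed.

(** Double counting of pairs of a coloring [f] and an [l]-set [C] of colors which all keep [f] in
    [S] when put at [b]: convexity bounds their number below, and the most frequent [C] is
    chosen. *)
Lemma box_step S B b l D : b \notin B ->
  depends_on S (b |: B) -> 0 < D -> 0 < l -> #|K| ^ #|T| <= #|S| * D ->
  2 * D * l <= #|K| ->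
  exists2 C : {set K}, #|C| = l &
  let S' := [set f | [forall c in C, update f b c \in S]] in
  depends_on S' B /\ #|K| ^ #|T| <= #|S'| * (2 * D) ^ l.
Proof.
move=> bB depS D0 l0 leS leK.
set k := #|K|; set N := k ^ #|T|.
pose m := k %/ D.
pose d f := #|[set c | update f b c \in S]|.
pose S' (C : {set K}) := [set f | [forall c in C, update f b c \in S]].
have m_l : l <= m by rewrite leq_divRL //; nia.
have sumd : N * m <= \sum_f d f.
  rewrite sum_card_fibers -/k -(leq_pmul2r D0) -mulnA.
  apply: (@leq_trans (N * k)); first by rewrite leq_mul2l leq_trunc_div orbT.
  by rewrite -mulnA mulnC leq_mul2l leS orbT.
(* Jensen's inequality: the tangent bounds at [m] are summed over [f], and [sumd] makes the linear
   terms favorable. *)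
have sumbin : N * 'C(m, l) <= \sum_f 'C(d f, l).
  case: l l0 {leK m_l} => // l _.
  have : \sum_f ('C(m, l.+1) + d f * 'C(m, l)) <=
         \sum_f ('C(d f, l.+1) + m * 'C(m, l)).
    by apply: leq_sum => f _; apply: bin_tangent.
  rewrite !big_split /= !sum_nat_const -big_distrl /= card_ffun -/k -/N.
  move: sumd; set s1 := \sum_f d f; set s2 := \sum_f _; nia.
have sumS' : \sum_f 'C(d f, l) = \sum_(C : {set K} | #|C| == l) #|S' C|.
  transitivity (\sum_f \sum_(C : {set K} | #|C| == l) (f \in S' C : nat)).
    apply: eq_bigr => f _; rewrite -cards_draws -sum1dep_card big_mkcondl.
    rewrite [LHS]big_mkcond [RHS]big_mkcond; apply: eq_bigr => C _.
    have -> : (f \in S' C) = (C \subset [set c | update f b c \in S]).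
      rewrite inE; apply/forall_inP/subsetP => h c /h; by rewrite ?inE.
    by case: ifP => //; case: ifP.
  rewrite exchange_big /=; apply: eq_bigr => C _.
  by rewrite -sum1_card [RHS]big_mkcond.
have [C /eqP cC leC] : exists2 C : {set K}, #|C| == l &
    N * 'C(m, l) <= #|S' C| * 'C(k, l).
  have -> : 'C(k, l) = #|[pred C : {set K} | #|C| == l]|.
    rewrite /k -[#|K|]cardsT -cards_draws; apply: eq_card => C.
    by rewrite !inE subsetT.
  apply: pigeonhole_sum; last by rewrite -sumS'.
  by rewrite muln_gt0 bin_gt0 m_l expn_gt0 andbT /k; lia.
exists C => //; split.
  move=> f g fg; rewrite !inE; apply: eq_forallb_in => c _.
  apply: depS => v; rewrite !inE !ffunE; case: eqP => //= _; exact: fg.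
have bin0 : 0 < 'C(m, l) by rewrite bin_gt0.
rewrite -(leq_pmul2r bin0); apply: leq_trans leC _.
by rewrite -mulnA leq_mul2l bin_ratio ?orbT.
Qed.

(* The constant 4 leaves room for the recursion: each of the n steps replaces D
   by (2 * D) ^ l, and 4 * (2 * D) ^ l <= (4 * D) ^ l as 1 < l. *)
Lemma box_of_density n S B l D :
  1 < l -> 0 < D -> #|B| <= n.+1 -> depends_on S B ->
  #|K| ^ #|T| <= #|S| * D -> l * (4 * D) ^ (l ^ n) <= #|K| ->
  contains_box S B l.
Proof.
move=> l1; elim: n S B D => [|n IHn] S B D D0 leB depS leS leK.
  by apply: (@box_subset1 _ _ _ D) => //; rewrite expn0 expn1 in leK; nia.
have le4 : l * (4 * D) <= #|K|.
  apply: leq_trans leK; rewrite leq_mul2l -{1}[4 * D]expn1 leq_exp2l ?orbT //.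
    by rewrite expn_gt0; lia.
  lia.
case: (leqP #|B| 1) => [B1|/ltnW /card_gt0P[b bB]].
  by apply: (@box_subset1 _ _ _ D) => //; nia.
have l0 := ltnW l1; have le2 : 2 * D * l <= #|K| by nia.
have bNB : b \notin B :\ b by rewrite !inE eqxx.
rewrite -(setD1K bB) in depS.
have [C cC [depS' leS']] := box_step bNB depS D0 l0 leS le2.
have [|||L cL LS] := IHn _ (B :\ b) ((2 * D) ^ l) _ _ depS' leS'.
- by rewrite expn_gt0; lia.
- by move: leB; rewrite (cardsD1 b) bB.
- apply: leq_trans leK; rewrite leq_mul2l expnS expnM leq_exp2r ?expn_gt0 ?l0 //.
  have -> : 4 * D = 2 * (2 * D) by lia.
  by rewrite [X in _ <= X]expnMn leq_mul2r (@leq_exp2l 2 2) // l1 !orbT.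
exists (fun v => if v == b then C else L v) => [v|f fL].
  by case: eqP.
have fb : f b \in C by have := fL b bB; rewrite eqxx.
have : f \in [set f | [forall c in C, update f b c \in S]].
  by apply: LS => v /setD1P[/negbTE vb /fL]; rewrite vb.
rewrite inE => /forall_inP/(_ _ fb); congr (_ \in S).
by apply/ffunP => v; rewrite ffunE; case: eqP => // ->.
Qed.

End Boxes.

(** * Losing colorings from lists, and how to glue them *)

Section ListColoring.
Variables (G : sgraph) (K : finType) (s : nat).
Variable guess : G -> {ffun G -> K} -> {set K}.
Hypothesis guess_local : forall v (f g : {ffun G -> K}),
  (forall w, adj v w -> f w = g w) -> guess v f = guess v g.
Hypothesis guess_small : forall v f, #|guess v f| <= s.

(* The coloring psi outside X is prescribed, so that a fixed guessing function
   on all of G serves for every piece of the tree. *)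
Definition list_losing l (U X : {set G}) :=
  forall (psi : {ffun G -> K}) (L : G -> {set K}),
  {in U, forall v, #|L v| = l} ->
  exists phi : {ffun G -> K},
    [/\ {in ~: X, phi =1 psi}, {in U, forall v, phi v \in L v}
      & {in X, forall v, phi v \notin guess v phi}].

(** Numbering each list identifies its colors with ['I_l], so guesses that never fail against the
    lists would win on [induced U] with [l] colors. *)
Lemma list_losing_part l U : HG s (induced U) < l -> list_losing l U U.
Proof.
move=> ltHG psi L cL.
pose col v (i : 'I_l) := nth (psi v) (enum (L v)) i.
have col_in v i : v \in U -> col v i \in L v.
  by move=> vU; rewrite -mem_enum mem_nth // -cardE cL.
have col_inj v : v \in U -> injective (col v).
  move=> vU i j /eqP; rewrite nth_uniq ?enum_uniq -?cardE ?cL //.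
  by move/eqP/val_inj.
pose fill (f : {x : G | x \in U} -> option 'I_l) : {ffun G -> K} :=
  [ffun w => if insub w is Some w' then
               if f w' is Some i then col w i else psi w
             else psi w].
(* Vertices of [U] not adjacent to [v] receive [psi], which [guess_local] makes harmless. *)
pose ext (v : induced U) (c : nbr_coloring l v) :=
  fill (fun w => omap c (insub w)).
pose F : strategy (induced U) l :=
  [ffun v => [ffun c => [set i | col (val v) i \in guess (val v) (ext v c)]]].
have : ~~ winning s F.
  apply/negP => winF; have /has_winning_leq : has_winning s (induced U) l.
    by apply/existsP; exists F.
  by rewrite leqNgt ltHG.
rewrite negb_and => /orP[/forallPn[v /forallPn[c]] | /forallPn[phi]].
  move=> /negP[]; rewrite !ffunE.
  apply: leq_trans (guess_small (val v) (ext v c)).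
  rewrite -(card_imset _ (col_inj (val v) (valP v))); apply: subset_leq_card.
  by apply/subsetP => _ /imsetP[i + ->]; rewrite inE.
rewrite negb_exists => /forallP lose.
exists (fill (fun w => Some (phi w))); split=> [w|w wU|w wU].
- by rewrite inE => wU; rewrite ffunE insubN.
- by rewrite ffunE (insubT (fun x => x \in U) wU) /= col_in.
have := lose (exist _ w wU); rewrite !ffunE inE /= (insubT (fun x => x \in U) wU) /=.
congr (~~ (_ \in pred_of_set _)); apply: guess_local => u wu; rewrite !ffunE.
case: insubP => // u' _ eu.
have adju : adj (exist _ w wU : induced U) u' by rewrite /= /induced_adj eu.
by rewrite (insubT _ adju) /= ffunE.
Qed.

Lemma list_losing_join l r (U W X Y : {set G}) :
  U \subset X -> W \subset Y -> [disjoint X & Y] ->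
  {in X & Y, forall v w, adj v w -> v \in U /\ w \in W} ->
  #|nbrs W :&: U| <= r -> 0 < l ->
  (forall S : {set {ffun G -> K}}, depends_on S (nbrs U :&: W) ->
     #|K| ^ #|G| <= #|S| * l ^ r -> contains_box S (nbrs U :&: W) l) ->
  list_losing l U X -> list_losing l W Y -> list_losing l U (X :|: Y).
Proof.
move=> /subsetP UX /subsetP WY disXY edge leA l0 box losX losY psi L cL.
set A := nbrs W :&: U; set B := nbrs U :&: W in box.
have XY v : v \in X -> v \in Y = false by move/(disjointFr disXY).
have nbrsP (V : {set G}) v w : v \in V -> adj w v -> w \in nbrs V.
  by move=> vV wv; rewrite inE; apply/exists_inP; exists v.
pose good (alpha beta : {ffun G -> K}) := exists phi : {ffun G -> K},
  [/\ {in ~: Y, phi =1 alpha}, {in B, phi =1 beta}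
    & {in Y, forall v, phi v \notin guess v phi}].
pose goodb (alpha beta : {ffun G -> K}) := [exists phi : {ffun G -> K},
  [&& [forall v in ~: Y, phi v == alpha v], [forall v in B, phi v == beta v]
    & [forall v in Y, phi v \notin guess v phi]]].
have goodP alpha beta : reflect (good alpha beta) (goodb alpha beta).
  apply: (iffP existsP) => -[phi]; exists phi.
    by case/and3P: p => /eqfun_inP ? /eqfun_inP ? /forall_inP.
  by case: p => /eqfun_inP ? /eqfun_inP ? /forall_inP ?; apply/and3P.
pose Alpha := family (fun v => if v \in A then mem (L v) else mem (pred1 (psi v))).
have cardAlpha : #|Alpha| <= l ^ r.
  rewrite card_family foldrE big_image /=.
  apply: leq_trans (leq_pexp2l l0 leA); rewrite -prod_nat_const [leqRHS]big_mkcond.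
  apply: leq_prod => v _; case: ifP => [/setIP[_ vU]|_]; last by rewrite card1.
  by rewrite cL.
(* Otherwise every [beta] is bad for some [alpha]; by the size of [Alpha], some [bad alpha] has
   density at least [1 / l ^ r] and contains a box. *)
have [beta goodbeta] : exists beta, forall alpha, alpha \in Alpha -> good alpha beta.
  case: (boolP [exists beta, [forall alpha in Alpha, goodb alpha beta]]).
    by case/existsP=> beta /forall_inP h; exists beta => alpha /h/goodP.
  rewrite negb_exists => /forallP nogood.
  have colors0 : 0 < #|{: {ffun G -> K}}| by apply/card_gt0P; exists psi.
  pose bad alpha := [set beta | ~~ goodb alpha beta].
  have [|alpha _ le_bad] := @pigeonhole_sum _ (mem Alpha) (fun alpha => #|bad alpha|)
      #|{: {ffun G -> K}}| colors0.
    apply: (@leq_trans (\sum_beta \sum_(alpha in Alpha) (beta \in bad alpha))).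
      rewrite -sum1_card; apply: leq_sum => beta _.
      have /forall_inPn[alpha Aalpha nalpha] := nogood beta.
      by rewrite (bigD1 alpha) //= inE nalpha.
    rewrite exchange_big; apply: leq_sum => alpha _.
    by rewrite -sum1_card [leqRHS]big_mkcond.
  have [f g fg||L' cL' L'bad] := box (bad alpha).
  - rewrite !inE; congr (~~ _); apply/goodP/goodP => -[phi [out on lose]];
      by exists phi; split=> // v vB; rewrite on ?fg.
  - by rewrite -card_ffun (leq_trans le_bad) // leq_mul2l cardAlpha orbT.
  (* A losing [phi] from the lists of the box lies in [bad alpha], yet witnesses
     [good alpha phi]. *)
  have [v _|phi [out listW lose]] := losY alpha L'; first exact: cL'.
  have : phi \in bad alpha by apply: L'bad => v /setIP[_ /listW].
  by rewrite inE => /goodP[]; exists phi.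
(* Order of choices: [beta] on [B], then [phiX] on [X] facing [beta], then [phiY] on [Y] facing the
   trace [alpha] of [phiX] on [A]. *)
pose psi' : {ffun G -> K} := [ffun v => if v \in B then beta v else psi v].
have [phiX [outX listX loseX]] := losX psi' L cL.
pose alpha : {ffun G -> K} := [ffun v => if v \in A then phiX v else psi v].
have /goodbeta[phiY [outY onB loseY]] : alpha \in Alpha.
  apply/familyP => v; rewrite ffunE; case: ifP => [/setIP[_ vU]|_].
    exact: listX.
  exact: eqxx.
(* [X] sees [Y] only in [B], where [phiY] equals [beta]; [Y] sees [X] only in [A], where [alpha]
   equals [phiX]. *)
pose phi : {ffun G -> K} := [ffun v => if v \in Y then phiY v else phiX v].
exists phi; split=> [v|v vU|v].
- rewrite !inE negb_or => /andP[vX vY]; rewrite ffunE (negbTE vY) outX ?inE //.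
  rewrite ffunE; case: ifP => // /setIP[_ /WY vY'].
  by rewrite vY' in vY.
- by rewrite ffunE XY ?UX // listX.
case/setUP => [vX|vY].
  rewrite ffunE XY //; have := loseX v vX; congr (~~ (_ \in pred_of_set _)).
  apply: guess_local => w vw; rewrite ffunE; case: ifP => // wY.
  have [vU wW] := edge v w vX wY vw.
  have wB : w \in B by rewrite inE wW (nbrsP U v) // adj_sym.
  rewrite onB // outX ?ffunE ?wB // inE.
  by apply: contraL wY => /XY ->.
rewrite ffunE vY; have := loseY v vY; congr (~~ (_ \in pred_of_set _)).
apply: guess_local => w vw; rewrite ffunE; case: ifP => // /negbT wY.
rewrite outY ?inE // ffunE; case: ifP => // /negbT wA.
case: (boolP (w \in X)) => [wX|wX].
  have [wU vW] : w \in U /\ v \in W by apply: edge => //; rewrite adj_sym.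
  by rewrite inE wU (nbrsP W v) // adj_sym in wA.
rewrite outX ?inE // ffunE; case: ifP => // /setIP[_ /WY].
by rewrite (negbTE wY).
Qed.

(** * Splitting a forest of parts into branches *)

(** [C] is a connected component of [N] without [u], so its outgoing edges within [N] end at [u].
    Two neighbors of [u] in [C], joined by a path avoiding [u], would close a cycle. *)
Lemma acyclic_branch (H : sgraph) (N : {set H}) u :
  acyclic_graph H -> u \in N -> N != [set u] ->
  exists (C : {set H}) w, [/\ C \subset N :\ u, w \in C &
    {in C & N :\: C, forall x y, adj x y -> x = w /\ y = u}].
Proof.
move=> acH uN neN.
have [w0 w0N] : exists w, w \in N :\ u.
  apply/set0Pn; apply: contraNneq neN => N0.
  by rewrite -(setD1K uN) N0 setU0.
pose e : rel H := fun x y => [&& x \in N :\ u, y \in N :\ u & adj x y].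
have e_sym : connect_sym e.
  apply: sym_connect_sym => x y; rewrite /e adj_sym.
  by case: (x \in _); case: (y \in _).
pose C := [set x | connect e w0 x].
have CN : C \subset N :\ u.
  apply/subsetP => x; rewrite inE e_sym => /connectP[[|y p] /=].
    by move=> _ <-.
  by case/andP => /and3P[].
have uC : u \notin C by apply/negP => /(subsetP CN); rewrite !inE eqxx.
have exit_C x y : x \in C -> y \in N :\: C -> adj x y -> y = u.
  move=> xC /setDP[yN yC] xy; apply: contraNeq yC => yu.
  have xN := subsetP CN x xC; rewrite inE in xC.
  rewrite inE; apply: connect_trans xC (connect1 _).
  by rewrite /e xy xN in_setD1 yu yN.
have nbr_u_uniq x y : x \in C -> y \in C -> adj u x -> adj u y -> x = y.
  rewrite !inE e_sym => wx wy ux uy; apply/eqP/negPn/negP => xy.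
  have /connectP[p ep ey] := connect_trans wx wy.
  case/shortenP: ep ey => p' ep' up' _ ey.
  have p'N : {in p', forall z, z \in N :\ u}.
    move: ep'; elim: (p') (x) => //= z q IHq t /andP[/and3P[_ zN _] /IHq h] v.
    by rewrite inE => /predU1P[->|/h].
  apply: (acH (u :: x :: p')).
    by case: (p') ey xy => //= ->; rewrite eqxx.
  apply/andP; split.
    rewrite /= ux rcons_path -ey adj_sym uy andbT.
    by apply: sub_path ep' => a b /and3P[].
  rewrite cons_uniq up' andbT inE negb_or; apply/andP; split.
    by apply: contraTneq ux => ->; rewrite adj_irr.
  by apply/negP => /p'N; rewrite !inE eqxx.
have w0C : w0 \in C by rewrite inE connect0.
exists C; case: (boolP [exists x in C, adj u x]) => [/exists_inP[w wC uw]|none].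
  exists w; split=> // x y xC yN xy; have yu := exit_C x y xC yN xy.
  by split=> //; apply: nbr_u_uniq => //; rewrite adj_sym -yu.
(* With no edge from [u] to [C], the condition on the root is vacuous and [w0] serves. *)
exists w0; split=> // x y xC yN xy; have yu := exit_C x y xC yN xy.
by case/exists_inP: none; exists x; rewrite // adj_sym -yu.
Qed.

(** Induction on [#|N|]: [acyclic_branch] cuts off a branch and [list_losing_join] glues it back. As
    [N] is an arbitrary set of parts, the induction hypothesis covers both pieces. *)
Lemma list_losing_acyclic l r (P : {set {set G}}) :
  trivIset P -> acyclic_graph (quotient_graph P) -> 0 < l ->
  {in P &, forall A B, A != B -> #|nbrs A :&: B| <= r} ->
  {in P, forall A, list_losing l A A} ->
  (forall (B : {set G}) (S : {set {ffun G -> K}}), #|B| <= r ->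
     depends_on S B -> #|K| ^ #|G| <= #|S| * l ^ r -> contains_box S B l) ->
  forall (N : {set quotient_graph P}) u, u \in N ->
  list_losing l (val u) (\bigcup_(A in N) val A).
Proof.
move=> tiP acP l0 leP baseP box N.
have [n] := ubnP #|N|; elim: n N => // n IHn N; rewrite ltnS => leN u uN.
have [->|neN] := eqVneq N [set u].
  by rewrite big_set1; apply: baseP; apply: valP.
have [C [w [CN wC exitC]]] := acyclic_branch acP uN neN.
have uC : u \notin C by apply/negP => /(subsetP CN); rewrite !inE eqxx.
have CsubN : C \subset N by apply: subset_trans CN (subD1set _ _).
have uNC : u \in N :\: C by rewrite inE uC.
have uw : val w != val u by rewrite val_eqE; apply: contraNneq uC => <-.
have -> : \bigcup_(A in N) val A =
    \bigcup_(A in N :\: C) val A :|: \bigcup_(A in C) val A.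
  by rewrite -bigcup_setU setUC -{1}(setIidPr CsubN) setID.
have disj (A B : quotient_graph P) v : v \in val A -> v \in val B -> A = B.
  move=> vA vB; apply/eqP; rewrite -val_eqE; apply/negPn/negP => AB.
  have /trivIsetP/(_ _ _ (valP A) (valP B) AB) := tiP.
  by move/(disjointFr)/(_ vA); rewrite vB.
apply: (@list_losing_join l r _ (val w)) => //.
- exact: (bigcup_sup u).
- exact: (bigcup_sup w).
- rewrite disjoint_subset; apply/subsetP => v /bigcupP[A AN vA].
  rewrite inE; apply/negP => /bigcupP[B BC /(disj _ _ _ vA) AB].
  by move: AN; rewrite AB inE BC.
- move=> v v' /bigcupP[A AN vA] /bigcupP[B BC vB] vv'.
  have AB : A != B by apply: contraTneq AN => ->; rewrite inE BC.
  have [|<- <-] // := exitC B A BC AN.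
  apply/andP; split; first by rewrite eq_sym.
  by apply/exists_inP; exists v' => //; apply/exists_inP; exists v; rewrite // adj_sym.
- by apply: leP => //; apply: valP.
- by move=> S; apply: box; apply: leP; rewrite 1?eq_sym //; apply: valP.
- apply: IHn => //; apply: leq_trans leN; apply: proper_card.
  by apply/properP; split; [apply: subsetDl|exists w; rewrite ?inE ?wC ?(subsetP CsubN)].
- apply: IHn => //; apply: leq_trans leN; apply: proper_card.
  by apply/properP; split=> //; exists u.
Qed.

End ListColoring.

(** * From losing colorings to bounds on [HG] *)

Theorem theorem2p5 (r s l : nat) (G : sgraph) (P : {set {set G}}) :
  1 <= r -> 1 <= s ->
  partition P [set: G] ->
  is_tree (quotient_graph P) ->
  (forall A B : {set G}, A \in P -> B \in P -> A != B ->
     #|nbrs A :&: B| <= r) ->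
  (forall A : {set G}, A \in P -> HG s (induced A) < l) ->
  (2 <= r -> HG s G <= (3 * l) ^ (r * l ^ (r - 1))) /\
  (r = 1 -> HG s G <= l * (l - 1)).
Proof.
move=> r1 s1 /and3P[/eqP covP tiP P0] [[H0 _] acP] leP ltHG.
have [A0 _] := card_gt0P H0.
have G0 : 0 < #|G|.
  apply: leq_trans (max_card (mem (val A0))); rewrite card_gt0.
  by apply: contraNneq P0 => <-; apply: valP.
(* With a single color, guessing it wins on a nonempty part, so [HG] of a part is at least 1. *)
have l1 : 1 < l.
  apply: leq_ltn_trans (ltHG _ (valP A0)); apply: has_winning_leq.
  apply/existsP; exists [ffun v => [ffun=> setT]]; apply/andP; split.
    by apply/forallP => v; apply/forallP => c; rewrite !ffunE cardsT card_ord.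
  have [v vA0] : exists v, v \in val A0.
    by apply/set0Pn; apply: contraNneq P0 => <-; apply: valP.
  by apply/forallP => phi; apply/existsP; exists (exist _ v vA0); rewrite !ffunE inE.
have lr : l <= l ^ r by rewrite -{1}[l]expn1 leq_exp2l.
(* Boxes in all these dense sets would yield, for any list on the root part, a coloring of [G] that
   defeats [F]. *)
have no_boxes k : l <= k -> has_winning s G k ->
    ~ (forall (B : {set G}) (S : {set {ffun G -> 'I_k}}), #|B| <= r ->
       depends_on S B -> #|'I_k| ^ #|G| <= #|S| * l ^ r -> contains_box S B l).
  move=> lk /existsP[F /andP[/forallP smallF /forallP winF]] box.
  pose guess v (f : {ffun G -> 'I_k}) := F v (restrict f v).
  have guess_local v (f g : {ffun G -> 'I_k}) :
      (forall w, adj v w -> f w = g w) -> guess v f = guess v g.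
    move=> fg; congr (F v _); apply/ffunP => -[w vw].
    by rewrite !ffunE fg.
  have guess_small v f : #|guess v f| <= s by apply: (forallP (smallF v)).
  have [C _ cC] : exists2 C : {set 'I_k}, C \subset setT & #|C| = l.
    by apply: ex_subset_card; rewrite cardsT card_ord.
  have losing := list_losing_acyclic guess_local tiP acP (ltnW l1)
    (fun A B PA PB => leP A B PA PB)
    (fun A PA => list_losing_part guess_local guess_small (ltHG A PA)) box.
  have k0 : 0 < k by apply: leq_trans lk; apply: ltnW.
  have [//|phi [_ _ lose]] :=
    losing setT A0 (in_setT _) [ffun=> Ordinal k0] (fun=> C).
  have /existsP[v] := winF phi; apply/negP; apply: lose.
  have : v \in cover P by rewrite covP inE.
  by case/bigcupP => A PA vA; apply/bigcupP; exists (exist _ A PA); rewrite ?inE.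
have winHG := has_winning_HG s G0.
split=> [r2|r_eq1]; rewrite leqNgt; apply/negP => ltk.
  (* l * 4 ^ N <= 8 ^ N <= (3 ^ r) ^ N for N := l ^ r.-1 *)
  have threshold : l * (4 * l ^ r) ^ (l ^ r.-1) <= HG s G.
    apply: leq_trans (ltnW ltk); rewrite subn1 expnM !expnMn mulnA.
    rewrite leq_mul2r; apply/orP; right.
    have leN : l <= l ^ r.-1 by rewrite -{1}[l]expn1 leq_exp2l // -subn1 subn_gt0.
    have N0 : 0 < l ^ r.-1 by apply: leq_trans leN; apply: ltnW.
    apply: (@leq_trans ((2 * 4) ^ (l ^ r.-1))).
      by rewrite expnMn leq_mul2r (leq_trans leN) ?orbT // ltnW // ltn_expl.
    by rewrite leq_exp2r // (@leq_trans (3 ^ 2)) // leq_exp2l.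
  apply: no_boxes winHG _.
    apply: leq_trans threshold; rewrite leq_pmulr // expn_gt0.
    by rewrite muln_gt0 expn_gt0 (ltnW l1).
  move=> B S leB depS leS; apply: (@box_of_density _ _ r.-1) leS _ => //.
  - by rewrite expn_gt0 (ltnW l1).
  - by rewrite prednK.
  - by rewrite card_ord.
apply: no_boxes winHG _; first by nia.
move=> B S; rewrite r_eq1 expn1 => leB depS leS.
by apply: box_subset1 leS _ => //; rewrite card_ord -subn1; lia.
Qed.
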